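(* Let $E$ be a $JC^*$-triple. Then there is a pair $(T^*(E), \alpha_E)$, where $T^*(E)$ is a TRO and $\alpha_E \colon E \to T^*(E)$ is an injective triple homomorphism, with the following properties: (a) $\alpha_E(E)$ generates $T^*(E)$ as a TRO; (b) for each triple homomorphism $\pi \colon E \to T$, where $T$ is a TRO, there is a unique TRO homomorphism $\tilde{\pi} \colon T^*(E) \to T$ such that $\tilde{\pi} \circ \alpha_E = \pi$. Moreover, the pair is unique up to natural equivalence with TRO isomorphism: if $(S, \beta)$ is another such pair then there is a TRO isomorphism $\theta \colon T^*(E) \to S$ with $\theta \circ \alpha_E = \beta$.
   Context: A TRO (ternary ring of operators) is a norm closed subspace of a $C^*$-algebra that is closed under the ternary product $[a,b,c] = ab^*c$. A TRO homomorphism is a linear map between TROs preserving this product; a TRO isomorphism is a bijective TRO homomorphism. A $JC^*$-subtriple of a TRO is a norm closed subspace $F$ closed under the triple product $\{a,b,c\} = \tfrac12(ab^*c + cb^*a)$. A $JC^*$-triple is a complex Banach space $E$ for which there is a surjective linear isometry $\phi \colon F \to E$ with $F$ a $JC^*$-subtriple of a TRO; the triple product on $E$ given by $\{\phi(a),\phi(b),\phi(c)\} = \phi(\{a,b,c\})$ is independent of $F$ and $\phi$. A triple homomorphism is a linear map preserving the triple product; a TRO is regarded as a $JC^*$-triple with $\{a,b,c\} = \tfrac12(ab^*c + cb^*a)$. A subset generates a TRO $T$ if $T$ is the smallest sub-TRO (norm closed) of $T$ containing it. *)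

(* Defs.v *)
From HB Require Import structures.
From mathcomp Require Import all_boot all_order all_algebra complex.
From mathcomp Require Import all_classical all_reals all_analysis.

Set Implicit Arguments.
Unset Strict Implicit.
Unset Printing Implicit Defensive.

Import Order.TTheory GRing.Theory Num.Theory.
Import numFieldNormedType.Exports.

Local Open Scope classical_set_scope.
Local Open Scope ring_scope.
Local Open Scope complex_scope.

(* C*-algebras are not assumed unital (and may be zero), so the product is not
   provided by a MathComp ring structure. *)
HB.mixin Record isCStarAlgebra (R : realType) A
    of CompleteNormedModule R[i] A := {
  cmul : A -> A -> A;
  cstar : A -> A;
  cmulA : associative cmul;
  cmulDl : left_distributive cmul +%R;
  cmulDr : right_distributive cmul +%R;
  cmulZl : forall (k : R[i]) (x y : A), cmul (k *: x) y = k *: cmul x y;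
  cmulZr : forall (k : R[i]) (x y : A), cmul x (k *: y) = k *: cmul x y;
  cstarD : {morph cstar : x y / x + y};
  cstarZ : forall (k : R[i]) (x : A), cstar (k *: x) = Num.conj k *: cstar x;
  cstarM : forall x y : A, cstar (cmul x y) = cmul (cstar y) (cstar x);
  cstarK : involutive cstar;
  cnormM : forall x y : A, `|cmul x y| <= `|x| * `|y|;
  cnorm_star : forall x : A, `|cmul (cstar x) x| = `|x| ^+ 2
}.

#[short(type="cstarAlgType")]
HB.structure Definition CStarAlgebra (R : realType) :=
  {A of isCStarAlgebra R A & CompleteNormedModule R[i] A}.

Section TernaryProducts.
Context {R : realType} {A : cstarAlgType R}.
Implicit Types (a b c : A) (S : submodClosed A).

Definition ternary a b c : A := cmul (cmul a (cstar b)) c.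

Definition jordan_triple a b c : A :=
  2^-1 *: (ternary a b c + ternary c b a).

Definition is_tro S : Prop :=
  closed [set x | x \in S] /\
  (forall a b c, a \in S -> b \in S -> c \in S -> ternary a b c \in S).

Definition is_jcstar_subtriple S : Prop :=
  closed [set x | x \in S] /\
  (forall a b c, a \in S -> b \in S -> c \in S -> jordan_triple a b c \in S).

End TernaryProducts.

Section Submodule.
Context {K : pzRingType} {V : lmodType K}.

Record submod (S : submodClosed V) :=
  Submod { submod_val : V; submod_valP : submod_val \in S }.

Variable S : submodClosed V.
HB.instance Definition _ := [isSub for @submod_val S].
HB.instance Definition _ := [Choice of submod S by <:].
HB.instance Definition _ := [SubChoice_isSubLmodule of submod S by <:].

End Submodule.

Record tro (R : realType) := Tro {
  tro_ambient : cstarAlgType R;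
  tro_space : submodClosed tro_ambient;
  tro_axiom : is_tro tro_space
}.

Definition tro_sort (R : realType) (T : tro R) := submod (tro_space T).
Coercion tro_sort : tro >-> Sortclass.

HB.instance Definition _ (R : realType) (T : tro R) :=
  GRing.SubLmodule.on (tro_sort T).

Section TroProducts.
Context {R : realType} {T : tro R}.

Definition tro_prod (a b c : T) : T :=
  Submod ((tro_axiom T).2 _ _ _
    (submod_valP a) (submod_valP b) (submod_valP c)).

Definition tro_triple (a b c : T) : T :=
  2^-1 *: (tro_prod a b c + tro_prod c b a).

End TroProducts.

(* The triple product is part of the structure; it is required to be the one
   transported from some JC*-subtriple F along a surjective linear isometry.
   Since it does not depend on F and phi, it is determined by the underlying
   Banach space. *)
HB.mixin Record isJCStarTriple (R : realType) E
    of CompleteNormedModule R[i] E := {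
  jc_triple : E -> E -> E -> E;
  jc_tripleP : exists (A : cstarAlgType R) (F : submodClosed A)
      (phi : {linear submod F -> E}),
    [/\ is_jcstar_subtriple F,
        forall y : E, exists x : submod F, phi x = y,
        forall x : submod F, `|phi x| = `|val x|
      & forall a b c d : submod F,
          val d = jordan_triple (val a) (val b) (val c) ->
          jc_triple (phi a) (phi b) (phi c) = phi d]
}.

#[short(type="jcstarTripleType")]
HB.structure Definition JCStarTriple (R : realType) :=
  {E of isJCStarTriple R E & CompleteNormedModule R[i] E}.

Section Morphisms.
Context {R : realType}.
Implicit Types (E : jcstarTripleType R) (S T : tro R).

Definition triple_hom E T (f : {linear E -> T}) : Prop :=
  forall a b c : E, f (jc_triple a b c) = tro_triple (f a) (f b) (f c).

Definition tro_hom S T (f : {linear S -> T}) : Prop :=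
  forall a b c : S, f (tro_prod a b c) = tro_prod (f a) (f b) (f c).

Definition tro_iso S T (f : {linear S -> T}) : Prop :=
  tro_hom f /\ bijective f.

Definition tro_generates T (X : set T) : Prop :=
  forall S : submodClosed (tro_ambient T), is_tro S ->
    {subset S <= tro_space T} -> (forall x : T, X x -> val x \in S) ->
    forall x : T, val x \in S.

Definition universal_tro E T (alpha : {linear E -> T}) : Prop :=
  [/\ triple_hom alpha, injective alpha,
      tro_generates (range alpha)
    & forall (U : tro R) (pi : {linear E -> U}), triple_hom pi ->
        exists pi' : {linear T -> U},
          [/\ tro_hom pi', pi' \o alpha =1 pi
            & forall rho : {linear T -> U},
                tro_hom rho -> rho \o alpha =1 pi -> rho =1 pi']].

End Morphisms.

(* Main.v *)
Require Import Defs.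
From HB Require Import structures.
From mathcomp Require Import all_boot all_order all_algebra complex.
From mathcomp Require Import all_classical all_reals all_analysis.
From mathcomp Require Import ring lra.

(* Every triple homomorphism pi from a JC*-triple to a TRO is bounded by 8.
   Indeed, if b has norm at most 1/8, a contraction argument yields a with
   a + {a, a, b} = i b. The images c, d of a, b satisfy c + {c, c, d} = i d,
   whatever their size. As y |-> {c, c, y} is Hermitian, i is not an eigenvalue
   of it, which forces cc*d = dc*c, that is d = c / (i - c*c); the C*-identity
   then gives |d| <= 1.

   Hence, on the formal expressions built from elements of E with the C*-algebra
   operations and uniform limits, the supremum of the norms of the evaluations
   along all pi is a finite C*-seminorm. Expressions modulo equality of all
   evaluations form a C*-algebra, and T*(E) is the TRO generated by E in it.
   Expressions are used, rather than the product of the target C*-algebras over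
   all pi, because the latter would live in a larger universe.

   Uniqueness of the extensions holds because TRO homomorphisms are triple
   homomorphisms, hence continuous, so that the equalizer of two of them is a
   closed TRO. *)

Set Implicit Arguments.
Unset Strict Implicit.
Unset Printing Implicit Defensive.

Import Order.TTheory GRing.Theory Num.Theory.
Import numFieldNormedType.Exports Normc.

Local Open Scope classical_set_scope.
Local Open Scope ring_scope.
Local Open Scope complex_scope.

(** * Real-valued norms and sequences *)

Lemma small_invS (R : realType) (e : R) : 0 < e ->
  exists N, forall n, (N <= n)%N -> n.+1%:R^-1 <= e.
Proof.
move=> e0; exists (Num.truncn e^-1) => n nN.
rewrite invf_ple ?posrE//; apply/ltW/(lt_le_trans (truncnS_gt _)).
by rewrite ler_nat.
Qed.

Section RealNorm.
Context {R : realType} {V : normedModType R[i]}.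
Implicit Types (x y : V) (k : R[i]).

(* The norm of [V] takes its values in [R[i]]. *)
Definition rnorm x : R := complex.Re `|x|.

Lemma rnormE x : `|x| = (rnorm x)%:C.
Proof. by rewrite RRe_real// normr_real. Qed.

Lemma rnorm_ge0 x : 0 <= rnorm x.
Proof. by rewrite -ler0c -rnormE. Qed.

Lemma rnorm0 : rnorm 0 = 0.
Proof. by rewrite /rnorm normr0. Qed.

Lemma rnorm0_eq0 x : rnorm x = 0 -> x = 0.
Proof. by move=> x0; apply/normr0_eq0; rewrite rnormE x0. Qed.

Lemma rnormN x : rnorm (- x) = rnorm x.
Proof. by rewrite /rnorm normrN. Qed.

Lemma rnormD x y : rnorm (x + y) <= rnorm x + rnorm y.
Proof. by rewrite -lecR rmorphD/= -!rnormE ler_normD. Qed.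

Lemma rnormB x y : rnorm (x - y) <= rnorm x + rnorm y.
Proof. by rewrite -(rnormN y) rnormD. Qed.

Lemma rdistC x y : rnorm (x - y) = rnorm (y - x).
Proof. by rewrite /rnorm distrC. Qed.

Lemma rnormZ k x : rnorm (k *: x) = normc k * rnorm x.
Proof. by apply: complexI; rewrite -rnormE normrZ rnormE rmorphM. Qed.

Lemma rcvgP (u : nat -> V) x : (u @ \oo --> x) <->
  (forall e : R, 0 < e ->
    exists N, forall n, (N <= n)%N -> rnorm (u n - x) <= e).
Proof.
split=> [/cvgrPdist_le ux e e0|ux].
  have [|N _ uN] := ux e%:C; first by rewrite ltcR.
  by exists N => n /uN; rewrite rnormE lecR rdistC.
apply/cvgrPdist_le => e e0.
have eE : e = (complex.Re e)%:C by rewrite RRe_real// realE ltW.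
have [|N uN] := ux (complex.Re e); first by rewrite -ltcR -eE.
by exists N => // n /uN; rewrite eE rnormE lecR rdistC.
Qed.

Lemma closed_rcvg (S : set V) (u : nat -> V) x :
  closed S -> (forall n, S (u n)) -> u @ \oo --> x -> S x.
Proof. by move=> cS Su ux; apply: (closed_cvg S cS) ux; exact: nearW. Qed.

Lemma closed_seqP (S : set V) :
  (forall (u : nat -> V) x, (forall n, S (u n)) -> u @ \oo --> x -> S x) ->
  closed S.
Proof.
move=> Sseq x clx.
have /choice[u hu] n : exists y, S y /\ rnorm (y - x) <= n.+1%:R^-1.
  have [|y [Sy]] := clx (ball x (n.+1%:R^-1)%:C).
    by apply: nbhsx_ballx; rewrite ltcR.
  rewrite -ball_normE/= rnormE ltcR rdistC => /ltW yx.
  by exists y.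
apply: (Sseq u) => [n|]; first by have [] := hu n.
apply/rcvgP => e e0.
have [N hN] := small_invS e0; exists N => n /hN.
exact: le_trans (hu n).2.
Qed.

End RealNorm.

Section Complete.
Context {R : realType} {V : completeNormedModType R[i]}.

Lemma rcauchy_cvg (u : nat -> V) :
  (forall e : R, 0 < e -> exists N, forall m n, (N <= m)%N -> (N <= n)%N ->
    rnorm (u m - u n) <= e) -> cvgn u.
Proof.
move=> uC; apply/cauchy_cvgP/cauchy_exP => e e0.
have eE : e = (complex.Re e)%:C by rewrite RRe_real// realE ltW.
have e2 : 0 < complex.Re e / 2 by rewrite divr_gt0// -ltcR -eE.
have [N uN] := uC _ e2.
exists (u N), N => // n /= Nn.
rewrite -ball_normE/= eE rnormE ltcR (le_lt_trans (uN _ _ _ Nn))//.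
by lra.
Qed.

End Complete.

(** * C*-algebras *)

Section CStarTheory.
Context {R : realType} {A : cstarAlgType R}.
Implicit Types (a b c x y : A) (k : R[i]).

Local Notation "x ∘ y" := (cmul x y) (at level 40, left associativity).
Local Notation "x ^†" := (cstar x) (at level 2, format "x ^†").

Lemma normc_ge0 k : 0 <= normc k.
Proof. by case: k => a b; exact: sqrtr_ge0. Qed.

Lemma normc_real (t : R) : normc t%:C = `|t|.
Proof. by rewrite /normc/= expr0n addr0 sqrtr_sqr. Qed.

Lemma normc_nat n : normc (n%:R : R[i]) = n%:R.
Proof.
by rewrite -(rmorph_nat (@real_complex_def R (Phant R))) normc_real normr_nat.
Qed.

Lemma normci : normc ('i : R[i]) = 1.
Proof. by rewrite /normc/= expr0n expr1n add0r sqrtr1. Qed.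

Lemma conjCi : Num.conj ('i : R[i]) = - 'i.
Proof. by apply/eqP; rewrite eq_complex/= !oppr0 !eqxx. Qed.

Lemma conjC_real (t : R) : Num.conj (t%:C : R[i]) = t%:C.
Proof. by apply/eqP; rewrite eq_complex/= !oppr0 !eqxx. Qed.

Lemma cmulNl x y : (- x) ∘ y = - (x ∘ y).
Proof. by rewrite -scaleN1r cmulZl scaleN1r. Qed.

Lemma cmulNr x y : x ∘ (- y) = - (x ∘ y).
Proof. by rewrite -scaleN1r cmulZr scaleN1r. Qed.

Lemma cmulBl x y z : (x - y) ∘ z = x ∘ z - y ∘ z.
Proof. by rewrite cmulDl cmulNl. Qed.

Lemma cmulBr x y z : z ∘ (x - y) = z ∘ x - z ∘ y.
Proof. by rewrite cmulDr cmulNr. Qed.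

Lemma cstarN x : (- x)^† = - x^†.
Proof. by rewrite -scaleN1r cstarZ rmorphN rmorph1 scaleN1r. Qed.

Lemma cstarB x y : (x - y)^† = x^† - y^†.
Proof. by rewrite cstarD cstarN. Qed.

Lemma rnormM x y : rnorm (x ∘ y) <= rnorm x * rnorm y.
Proof. by rewrite -lecR rmorphM/= -!rnormE cnormM. Qed.

Lemma rnorm_cstarM x : rnorm (x^† ∘ x) = rnorm x ^+ 2.
Proof. by apply: complexI; rewrite -rnormE cnorm_star rnormE rmorphXn. Qed.

(** The C*-identity gives |y|^2 = |y* y| <= |y*| |y|; the other inequality is this one at x*. *)
Lemma rnorm_cstar x : rnorm x^† = rnorm x.
Proof.
have le y : rnorm y <= rnorm y^†.
  have [->|y0] := eqVneq (rnorm y) 0; first exact: rnorm_ge0.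
  have yp : 0 < rnorm y by rewrite lt_def y0 rnorm_ge0.
  by rewrite -(ler_pM2r yp) -expr2 -rnorm_cstarM rnormM.
by apply/le_anti; rewrite le -{2}(cstarK x) le.
Qed.

Lemma rnorm_jordan a b c :
  rnorm (jordan_triple a b c) <= rnorm a * rnorm b * rnorm c.
Proof.
have ter x y z : rnorm (ternary x y z) <= rnorm x * rnorm y * rnorm z.
  apply: (le_trans (rnormM _ _)); rewrite ler_wpM2r ?rnorm_ge0//.
  by rewrite -(rnorm_cstar y) rnormM.
rewrite /jordan_triple rnormZ normcV normc_nat.
have := rnormD (ternary a b c) (ternary c b a).
have := ter a b c; have := ter c b a.
by lra.
Qed.

Lemma jordanBl a a' b c :
  jordan_triple (a - a') b c = jordan_triple a b c - jordan_triple a' b c.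
Proof.
rewrite /jordan_triple /ternary !cmulBl cmulBr -scalerBr; congr (_ *: _).
by rewrite opprD addrACA.
Qed.

Lemma jordanBm a b b' c :
  jordan_triple a (b - b') c = jordan_triple a b c - jordan_triple a b' c.
Proof.
rewrite /jordan_triple /ternary !cstarB !cmulBr !cmulBl -scalerBr.
by congr (_ *: _); rewrite opprD addrACA.
Qed.

(* For a skew-adjoint multiple [k P] of a self-adjoint [P], the operator
   [1 + k P] is close to a unitary when [k] is small. *)
Lemma rnorm_near_unitary_l (P y : A) k : P^† = P -> Num.conj k = - k ->
  rnorm (y + k *: (P ∘ y)) <=
    (1 + normc k ^+ 2 * rnorm P ^+ 2) * rnorm y.
Proof.
move=> Psa kconj; set z := y + _.
set s := normc k ^+ 2 * rnorm P ^+ 2.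
have s0 : 0 <= s by rewrite mulr_ge0 ?sqr_ge0.
(* The first-order cross terms cancel because [k] is skew and [P] self-adjoint. *)
have zz : z^† ∘ z = y^† ∘ y - (k ^+ 2) *: ((P ∘ y)^† ∘ (P ∘ y)).
  rewrite /z cstarD cstarZ kconj cstarM Psa cmulDl !cmulDr.
  rewrite !cmulZl !cmulZr scalerA -!cmulA mulNr -expr2 scaleNr.
  by rewrite addrA -(addrA (y^† ∘ y)) subrr addr0 scaleNr.
have zle : rnorm z ^+ 2 <= (1 + s) * rnorm y ^+ 2.
  rewrite -rnorm_cstarM zz (le_trans (rnormB _ _))// rnormZ !rnorm_cstarM.
  rewrite mulrDl mul1r lerD2l [k ^+ 2]expr2 normcM -expr2.
  rewrite /s -mulrA ler_wpM2l ?sqr_ge0// -exprMn.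
  by rewrite ler_pXn2r ?nnegrE ?rnorm_ge0 ?mulr_ge0 ?rnorm_ge0// rnormM.
have := rnorm_ge0 y; have := rnorm_ge0 z.
move: zle; move: (rnorm z) (rnorm y) => u v zle u0 v0.
rewrite -(@ler_pXn2r _ 2) ?nnegrE ?mulr_ge0 ?addr_ge0//.
rewrite (le_trans zle)// exprMn ler_wpM2r ?sqr_ge0//.
by rewrite ler_eXnr// ?lerDl.
Qed.

Lemma rnorm_near_unitary_r (P y : A) k : P^† = P -> Num.conj k = - k ->
  rnorm (y + k *: (y ∘ P)) <=
    (1 + normc k ^+ 2 * rnorm P ^+ 2) * rnorm y.
Proof.
move=> Psa kconj; rewrite -rnorm_cstar cstarD cstarZ cstarM Psa kconj.
rewrite -(rnorm_cstar y) -(normcN k); apply: rnorm_near_unitary_l => //.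
by rewrite rmorphN/= kconj.
Qed.

(* [y |-> (P y + y Q) / 2] is a Hermitian operator, so the non-real number
   [i] is not an eigenvalue. *)
Lemma sylvester_inj (P Q y : A) : P^† = P -> Q^† = Q ->
  P ∘ y + y ∘ Q = (2 * 'i) *: y -> y = 0.
Proof.
move=> Psa Qsa Py; apply: rnorm0_eq0; apply/eqP; rewrite eq_le rnorm_ge0 andbT.
rewrite leNgt; apply/negP => y0.
pose p := rnorm P; pose q := rnorm Q.
have p0 : 0 <= p := rnorm_ge0 _; have q0 : 0 <= q := rnorm_ge0 _.
(* The estimates below yield 1 + 2e <= 1 + e^2 (p^2 + q^2 + pq + e^2 p^2 q^2). As e <= 1, the
   bracket is at most [K], and the choice of [e] gives e^2 K <= e, a contradiction. *)
pose K := p ^+ 2 + q ^+ 2 + p * q + p ^+ 2 * q ^+ 2.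
have K0 : 0 <= K by rewrite /K; nra.
pose e := (1 + K)^-1.
have e0 : 0 < e by rewrite invr_gt0; lra.
have eK : e * (1 + K) = 1 by rewrite mulVf// lt0r_neq0//; lra.
(* Skew, as the near-unitary estimates require, and such that [k] times the eigenvalue 2i is the
   positive real 2e. *)
pose k : R[i] := - ('i * e%:C).
have kconj : Num.conj k = - k.
  by rewrite /k rmorphN rmorphM/= conjCi conjC_real mulNr.
have kn : normc k = e.
  by rewrite /k normcN normcM normci normc_real mul1r gtr0_norm.
have k2 : k ^+ 2 = - (e ^+ 2)%:C.
  by rewrite /k sqrrN exprMn sqr_i mulN1r rmorphXn.
have k2i : k * (2 * 'i) = (2 * e)%:C.
  have -> : k * (2 * 'i) = - ('i ^+ 2) * (2 * e%:C) by rewrite /k; ring.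
  by rewrite sqr_i opprK mul1r rmorphM/= rmorph_nat.
clearbody k; pose z := y + k *: (y ∘ Q).
have := rnorm_near_unitary_r y Qsa kconj; rewrite kn -/z -/q => hz.
have := rnorm_near_unitary_l z Psa kconj; rewrite kn -/p => hzz.
(* Two near-unitaries applied to [y] stretch it by 1 + 2e up to second order, while their norms
   exceed 1 only to second order. *)
have zz : z + k *: (P ∘ z) = (1 + 2 * e)%:C *: y - (e ^+ 2)%:C *: (P ∘ y ∘ Q).
  rewrite /z cmulDr cmulZr scalerDr scalerA -expr2 k2 scaleNr cmulA.
  rewrite addrA -(addrA y) -scalerDr [_ + P ∘ y]addrC Py scalerA k2i.
  by rewrite rmorphD rmorph1 scalerDl scale1r.
have ypos : (1 + 2 * e) * rnorm y <=
    rnorm (z + k *: (P ∘ z)) + e ^+ 2 * (p * q * rnorm y).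
  have rC (t : R) : 0 <= t -> normc t%:C = t.
    by move=> t0; rewrite normc_real ger0_norm.
  have {1}<- : normc (1 + 2 * e)%:C = 1 + 2 * e by rewrite rC//; lra.
  rewrite -rnormZ zz.
  rewrite -[X in rnorm X <= _](subrK ((e ^+ 2)%:C *: (P ∘ y ∘ Q))).
  rewrite (le_trans (rnormD _ _))// lerD2l rnormZ rC ?sqr_ge0//.
  rewrite ler_wpM2l ?sqr_ge0// (le_trans (rnormM _ _))//.
  rewrite mulrAC ler_wpM2r// rnormM//.
have : 1 + 2 * e <=
    (1 + e ^+ 2 * p ^+ 2) * (1 + e ^+ 2 * q ^+ 2) + e ^+ 2 * (p * q).
  rewrite -(ler_pM2r y0) (le_trans ypos)// mulrDl mulrA lerD2r.
  apply: (le_trans hzz); rewrite -[leRHS]mulrA ler_wpM2l//.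
  by rewrite addr_ge0// mulr_ge0 ?sqr_ge0.
have eKe : e * K = 1 - e by move: eK; rewrite mulrDr mulr1 => <-; ring.
have e1 : e <= 1 by rewrite -subr_ge0 -eKe mulr_ge0// ltW.
have : e ^+ 2 * (p ^+ 2 + q ^+ 2 + p * q + e ^+ 2 * (p ^+ 2 * q ^+ 2)) <= e.
  apply: (@le_trans _ _ (e ^+ 2 * K)).
    rewrite ler_wpM2l ?sqr_ge0// /K lerD2l ler_piMl ?mulr_ge0 ?sqr_ge0//.
    by rewrite exprn_ile1// ltW.
  by rewrite expr2 -mulrA eKe mulrBr mulr1 gerBl mulr_ge0// ltW.
by lra.
Qed.

Lemma cstar_mulr_sa x : (x^† ∘ x)^† = x^† ∘ x.
Proof. by rewrite cstarM cstarK. Qed.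

Lemma cstar_mull_sa x : (x ∘ x^†)^† = x ∘ x^†.
Proof. by rewrite cstarM cstarK. Qed.

(* By [sylvester_inj], [d = c / (i - c* c)], and [|s / (i - s^2)| <= 1] for
   real [s], whatever the size of [c]. *)
Lemma rnorm_odd_resolvent (c d : A) :
  c + jordan_triple c c d = 'i *: d -> rnorm d <= 1.
Proof.
move=> cd; set P := c ∘ c^†; set Q := c^† ∘ c.
have PQ : P ∘ d + d ∘ Q = (2 * 'i) *: d - 2 *: c.
  have -> : P ∘ d + d ∘ Q = 2 *: jordan_triple c c d.
    rewrite /jordan_triple scalerA divff ?pnatr_eq0// scale1r.
    by rewrite /ternary -(cmulA d).
  by rewrite -scalerA -scalerBr -cd [c + _]addrC addrK.
have Pc : P ∘ c = c ∘ Q by rewrite /P /Q cmulA.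
(* Multiplying [PQ] by [P] on the left and by [Q] on the right and subtracting eliminates [c], as P
   c = c Q. So P d - d Q solves the homogeneous equation of [sylvester_inj]. *)
have PdQ : P ∘ d = d ∘ Q.
  apply/eqP; rewrite -subr_eq0; apply/eqP.
  apply: (@sylvester_inj P Q); rewrite ?cstar_mulr_sa ?cstar_mull_sa//.
  have PPd : P ∘ (P ∘ d) + P ∘ d ∘ Q = (2 * 'i) *: (P ∘ d) - 2 *: (P ∘ c).
    by rewrite -(cmulA P) -cmulDr PQ cmulBr !cmulZr.
  have dQQ : P ∘ d ∘ Q + d ∘ Q ∘ Q = (2 * 'i) *: (d ∘ Q) - 2 *: (c ∘ Q).
    by rewrite -cmulDl PQ cmulBl !cmulZl.
  rewrite cmulBr cmulBl (cmulA P d Q) addrA subrK 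
    -(addrKA (P ∘ d ∘ Q) (P ∘ (P ∘ d)) (d ∘ Q ∘ Q)) PPd dQQ.
  by rewrite Pc opprB addrA subrK -scalerBr.
have Pd : P ∘ d = 'i *: d - c.
  apply: (scalerI (a := 2)); first by rewrite pnatr_eq0.
  by rewrite scalerBr scalerA -PQ -PdQ scaler_nat mulr2n.
(* As g* g is self-adjoint, it has the two expressions [gg] and [gg']. Their sum is 2 g* g = - g* -
   g, whence |g| <= 1; their difference is 2i d* d = g* - g, whence |d|^2 <= |g|. *)
pose g := c^† ∘ d.
have gg : g^† ∘ g = 'i *: (d^† ∘ d) - g^†.
  by rewrite /g cstarM cstarK -cmulA (cmulA c) -/P Pd cmulBr cmulZr.
have gg' : g^† ∘ g = - ('i *: (d^† ∘ d)) - g.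
  rewrite -{1}(cstar_mulr_sa g) gg cstarB cstarK cstarZ cstar_mulr_sa.
  rewrite -scaleNr; congr (_ *: _ - _).
  by rewrite conjCi.
have r2 : normc (2 : R[i]) = 2 by exact: normc_nat.
have g1 : rnorm g <= 1.
  have : 2 * rnorm g ^+ 2 <= 2 * rnorm g.
    rewrite -rnorm_cstarM -{1}r2 -rnormZ scaler_nat mulr2n.
    rewrite {1}gg gg'.
    have -> : 'i *: (d^† ∘ d) - g^† + (- ('i *: (d^† ∘ d)) - g) = - g^† - g.
      by rewrite addrACA subrr add0r.
    by rewrite (le_trans (rnormB _ _))// rnormN rnorm_cstar; lra.
  have := rnorm_ge0 g; nra.
have : 2 * rnorm d ^+ 2 <= 2 * rnorm g.
  have i1 : normc (2 * 'i : R[i]) = 2 by rewrite normcM normci r2 mulr1.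
  rewrite -rnorm_cstarM -{1}i1 -rnormZ -scalerA scaler_nat mulr2n.
  have -> : 'i *: (d^† ∘ d) + 'i *: (d^† ∘ d) = g^† - g.
    have X1 : 'i *: (d^† ∘ d) = g^† ∘ g + g^† by rewrite gg subrK.
    have X2 : 'i *: (d^† ∘ d) = - (g^† ∘ g) - g.
      by rewrite gg' opprB opprK addrAC subrr add0r.
    by rewrite {1}X1 X2 addrACA subrr add0r.
  by rewrite (le_trans (rnormB _ _))// rnorm_cstar; lra.
have := rnorm_ge0 d; nra.
Qed.

Lemma submodClosedB (F : submodClosed A) x y :
  x \in F -> y \in F -> x - y \in F.
Proof. by move=> xF yF; rewrite -scaleN1r rpredD// rpredZ. Qed.

(* [a |-> i b - {a, a, b}] is a contraction of the unit ball. *)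
Lemma odd_resolvent_solve (F : submodClosed A) (b : A) :
  is_jcstar_subtriple F -> b \in F -> rnorm b <= 8^-1 ->
  exists2 a, a \in F & a + jordan_triple a a b = 'i *: b.
Proof.
move=> [Fcl Ftr] bF b8.
pose G (a : A) : A := 'i *: b - jordan_triple a a b.
pose u n := iter n G 0.
have uS n : u n.+1 = G (u n) by [].
have uF n : u n \in F.
  elim: n => [|n IH]; first exact: rpred0.
  by apply: submodClosedB; [exact: rpredZ|exact: Ftr].
have u1 n : rnorm (u n) <= 1.
  elim: n => [|n IH]; first by rewrite rnorm0.
  rewrite uS /G (le_trans (rnormB _ _))// rnormZ normci mul1r.
  have := rnorm_jordan (u n) (u n) b.
  have := rnorm_ge0 (u n); have := rnorm_ge0 b.
  nra.
(* The difference splits into two triple products, each of norm at most |x - y| / 8. *)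
have Glip (x y : A) : rnorm x <= 1 -> rnorm y <= 1 ->
    rnorm (G x - G y) <= 2^-1 * rnorm (x - y).
  move=> x1 y1.
  have -> : G x - G y =
      - (jordan_triple (x - y) x b + jordan_triple y (x - y) b).
    rewrite jordanBl jordanBm addrA subrK /G.
    by rewrite !opprB addrC addrA subrK.
  rewrite rnormN (le_trans (rnormD _ _))//.
  have := rnorm_jordan (x - y) x b; have := rnorm_jordan y (x - y) b.
  have small (z : A) : rnorm z <= 1 -> rnorm (x - y) * (rnorm z * rnorm b) <=
      rnorm (x - y) * 8^-1.
    move=> z1; rewrite ler_wpM2l ?rnorm_ge0// (le_trans _ b8)//.
    by rewrite ler_piMl ?rnorm_ge0.
  have := small x x1; have := small y y1; have := rnorm_ge0 (x - y); lra.
have step n : rnorm (u n.+1 - u n) <= 2^-1 ^+ n.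
  elim: n => [|n IH]; first by rewrite subr0 u1.
  apply: (le_trans (Glip _ _ (u1 n.+1) (u1 n))).
  by rewrite exprS ler_wpM2l ?invr_ge0.
have dist n (k : nat) : rnorm (u (n + k)%N - u n) <= 2 * 2^-1 ^+ n.
  (* The subtracted tail of the geometric series lets the induction on [k] go through. *)
  suff h : rnorm (u (n + k)%N - u n) <= 2 * 2^-1 ^+ n - 2 * 2^-1 ^+ (n + k).
    by rewrite (le_trans h)// gerBl mulr_ge0// exprn_ge0// invr_ge0.
  elim: k => [|k IH]; first by rewrite addn0 !subrr rnorm0.
  rewrite addnS -(subrKA (u (n + k)%N)) (le_trans (rnormD _ _))//.
  have := step (n + k)%N; rewrite exprS; lra.
have cvu : cvgn u.
  apply: rcauchy_cvg => e e0.
  have [|N /(_ _ (leqnn N)) hN] := @small_invS R (e / 4); first by lra.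
  exists N => m n Nm Nn.
  have pow : 2^-1 ^+ N <= N.+1%:R^-1 :> R.
    rewrite exprVn lef_pV2 ?posrE ?exprn_gt0// -natrX ler_nat.
    exact: ltn_expl.
  rewrite -(subrKA (u N)) (le_trans (rnormD _ _))// (rdistC (u N)).
  have := dist N (m - N)%N; have := dist N (n - N)%N.
  rewrite (subnKC Nm) (subnKC Nn).
  by move: (le_trans pow hN); move: (2^-1 ^+ N) => t; lra.
have [a ua] : exists a, u @ \oo --> a by exists (limn u).
have aF : a \in F by exact: (closed_rcvg Fcl uF ua).
have ua' e : 0 < e -> exists n, rnorm (u n - a) <= e /\ rnorm (u n.+1 - a) <= e.
  move=> e0; have [N hN] := (rcvgP _ _).1 ua e e0.
  by exists N; split; apply: hN.
have a1 : rnorm a <= 1.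
  apply/ler_addgt0Pr => e e0; have [n [une _]] := ua' e e0.
  have := rnormB (u n) (u n - a); rewrite opprB addrC subrK.
  by have := u1 n; lra.
exists a => //.
apply/eqP; rewrite -subr_eq0; apply/eqP/rnorm0_eq0/eqP.
rewrite eq_le rnorm_ge0 andbT; apply/ler_addgt0Pr => e e0; rewrite add0r.
have [|n [une uSe]] := ua' (e / 2); first by lra.
(* The left side is a - G a, and G (u n) is the next iterate. *)
have -> : a + jordan_triple a a b - 'i *: b = (G (u n) - G a) - (u n.+1 - a).
  have tel (x y z : A) : x - y = (z - y) - (z - x).
    by rewrite opprB [RHS]addrC subrKA.
  by rewrite -[RHS]tel /G opprB addrA.
rewrite (le_trans (rnormB _ _))//.
have := Glip (u n) a (u1 n) a1; have := rnorm_ge0 (u n - a); lra.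
Qed.

End CStarTheory.

(** * Boundedness of triple homomorphisms *)

(** Subspaces defined by a proposition, such as intersections and equalizers, enter the boolean
    membership structure through this classical conversion. *)
Lemma submodClosed_of (K : pzRingType) (V : lmodType K) (P : V -> Prop) :
  P 0 -> (forall x y, P x -> P y -> P (x + y)) ->
  (forall k x, P x -> P (k *: x)) ->
  exists S : submodClosed V, forall x, x \in S <-> P x.
Proof.
move=> P0 PD PZ; pose p : {pred V} := fun x => `[< P x >].
have pP x : x \in p <-> P x by split=> [/asboolP|Px]//; exact/asboolP.
have pD : Algebra.addumagma_closed p.
  by split=> [|x y /pP Px /pP Py]; apply/pP => //; exact: PD.
have pZ : GRing.scaler_closed p by move=> k x /pP Px; apply/pP; exact: PZ.
pose pA := GRing.isAddClosed.Build V p pD.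
pose pS := GRing.isScaleClosed.Build K V p pZ.
pose S : submodClosed V := HB.pack p pA pS.
by exists S.
Qed.

Lemma linear_of (K : pzRingType) (U V : lmodType K) (f : U -> V) :
  linear f -> exists g : {linear U -> V}, g =1 f.
Proof.
move=> fL; pose fM := GRing.isLinear.Build K U V *:%R f fL.
pose g : {linear U -> V} := HB.pack f fM.
by exists g.
Qed.

Section TripleMaps.
Context {R : realType}.

(** If |b| <= 1/8, the image under [f] of a solution of the odd resolvent equation for [b] solves it
    for [f b], so |f b| <= 1. Scaling gives the constant 8. *)
Lemma triple_map_bounded (A B : cstarAlgType R) (F : submodClosed A)
    (f : {linear submod F -> B}) :
  is_jcstar_subtriple F ->
  (forall a b c d : submod F, val d = jordan_triple (val a) (val b) (val c) ->
    f d = jordan_triple (f a) (f b) (f c)) ->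
  forall x, rnorm (f x) <= 8 * rnorm (val x).
Proof.
move=> FJ fJ x.
have small (b : submod F) : rnorm (val b) <= 8^-1 -> rnorm (f b) <= 1.
  move=> b8; have [a aF ab] := odd_resolvent_solve FJ (valP b) b8.
  pose a' : submod F := Submod aF.
  pose d : submod F := Submod (FJ.2 _ _ _ aF aF (valP b)).
  apply: (@rnorm_odd_resolvent _ _ (f a')).
  have a'E : a' + d = 'i *: b by apply: val_inj.
  by rewrite -(fJ a' a' b d)// -linearZ/= -a'E linearD.
have [x0|x0] := eqVneq (rnorm (val x)) 0.
  have -> : x = 0 by apply: val_inj; rewrite (rnorm0_eq0 x0) raddf0.
  by rewrite !raddf0 !rnorm0 mulr0.
have xp : 0 < rnorm (val x) by rewrite lt_def x0 rnorm_ge0.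
pose t : R := (8 * rnorm (val x))^-1.
have t0 : 0 < t by rewrite invr_gt0 mulr_gt0.
have tx : rnorm (val (t%:C *: x)) <= 8^-1.
  rewrite linearZ/= rnormZ normc_real gtr0_norm// /t.
  by rewrite invfM -mulrA mulVf ?mulr1.
have := small _ tx; rewrite linearZ/= rnormZ normc_real gtr0_norm// /t.
by rewrite ler_pdivrMl ?mulr_gt0// mulr1.
Qed.

Lemma val_tro_prod (T : tro R) (a b c : T) :
  val (tro_prod a b c) = ternary (val a) (val b) (val c).
Proof. by []. Qed.

Lemma val_tro_triple (T : tro R) (a b c : T) :
  val (tro_triple a b c) = jordan_triple (val a) (val b) (val c).
Proof. by []. Qed.

Lemma tro_subtriple (A : cstarAlgType R) (S : submodClosed A) :
  is_tro S -> is_jcstar_subtriple S.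
Proof.
move=> [Scl Str]; split=> // a b c aS bS cS.
by apply: rpredZ; apply: rpredD; exact: Str.
Qed.

Lemma tro_hom_bounded (S T : tro R) (f : {linear S -> T}) : tro_hom f ->
  forall x, rnorm (val (f x)) <= 8 * rnorm (val x).
Proof.
move=> fh; pose g : {linear submod (tro_space S) -> tro_ambient T} := val \o f.
apply: (@triple_map_bounded _ _ _ g); first exact/tro_subtriple/tro_axiom.
move=> a b c d dE.
have -> : d = tro_triple (T := S) a b c by apply: val_inj.
by rewrite /g/= /tro_triple linearZ linearD/= !fh.
Qed.

(** The type [envelope] below ranges over these representations only inside propositions, so their
    size does not affect its universe. *)
Record triple_rep (E : jcstarTripleType R) := TripleRep {
  rep_tro : tro R;
  rep_map : {linear E -> rep_tro};
  rep_hom : triple_hom rep_map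
}.

(** That the constant is the same for all [r] makes the supremum norm of a generator finite. The
    isometry [phi] reduces the bound to a subtriple. *)
Lemma rep_bounded (E : jcstarTripleType R) (r : triple_rep E) x :
  rnorm (val (rep_map r x)) <= 8 * rnorm x.
Proof.
have [A [F [phi [FJ phis phin phiJ]]]] := @jc_tripleP R E.
pose g : {linear submod F -> tro_ambient (rep_tro r)} :=
  val \o (rep_map r \o phi).
have [y <-] := phis x.
have -> : rnorm (phi y) = rnorm (val y) by rewrite /rnorm phin.
apply: (@triple_map_bounded _ _ _ g) => // a b c d dE.
by rewrite /g/= -(phiJ _ _ _ _ dE) rep_hom.
Qed.

(** The inverse of [phi], with all of [A] as target TRO. It provides a representation for the
    supremum norm to range over, and later the injectivity of [alpha]. *)
Lemma triple_embedding (E : jcstarTripleType R) :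
  exists r : triple_rep E, injective (rep_map r).
Proof.
have [A [F [phi [FJ phis phin phiJ]]]] := @jc_tripleP R E.
have [S SP] := @submodClosed_of _ A (fun=> True) I (fun _ _ _ _ => I)
  (fun _ _ _ => I).
have inS x : x \in S by exact/SP.
have StroP : is_tro S.
  split=> //; rewrite (_ : [set x | _] = setT); first exact: closedT.
  by apply/seteqP; split=> // x _; exact: inS.
pose U := Tro StroP.
have phi_inj : injective phi.
  move=> x y xy; apply/eqP; rewrite -subr_eq0; apply/eqP/val_inj.
  by apply/normr0_eq0; rewrite -phin linearB xy subrr normr0.
have [psi psiK] := choice phis.
have phiK x : psi (phi x) = x by apply: phi_inj.
pose f (y : E) : U := Submod (inS (val (psi y))).
have fL : linear f.
  move=> k x y; apply: val_inj => /=.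
  suff -> : psi (k *: x + y) = k *: psi x + psi y by [].
  by apply: phi_inj; rewrite linearP !psiK.
have [g gf] := linear_of fL.
have gh : triple_hom g.
  move=> a b c; rewrite !gf; apply: val_inj; rewrite val_tro_triple/=.
  pose d : submod F := Submod (FJ.2 _ _ _ (valP (psi a)) (valP (psi b))
    (valP (psi c))).
  have := phiJ (psi a) (psi b) (psi c) d erefl; rewrite !psiK => ->.
  by rewrite phiK.
exists (TripleRep gh) => x y /=; rewrite !gf => -[xy].
by rewrite -(psiK x) -(psiK y) (_ : psi x = psi y)//; exact: val_inj.
Qed.

End TripleMaps.

(** * The enveloping C*-algebra *)

Section Terms.
Context {R : realType} {E : jcstarTripleType R}.
Implicit Types (r : triple_rep E).

Definition rep_alg r : cstarAlgType R := tro_ambient (rep_tro r).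

(** Zero is encoded as [Gen 0] and the opposite as scaling by -1. [Lim] accepts any sequence; [good]
    imposes convergence. *)
Inductive term :=
  | Gen of E
  | Add of term & term
  | Scale of R[i] & term
  | Mul of term & term
  | Star of term
  | Lim of (nat -> term).

HB.instance Definition _ := gen_eqMixin term.
HB.instance Definition _ := gen_choiceMixin term.

Implicit Types s t : term.

Fixpoint eval r t : rep_alg r :=
  match t with
  | Gen x => val (rep_map r x)
  | Add s t => eval r s + eval r t
  | Scale k t => k *: eval r t
  | Mul s t => cmul (eval r s) (eval r t)
  | Star t => cstar (eval r t)
  | Lim u => lim (eval r (u n) @[n --> \oo])
  end.

(* Convergence uniform in [r] keeps the norms of all evaluations of a term
   bounded. *)
Fixpoint good t : Prop :=
  match t with
  | Gen _ => True
  | Add s t | Mul s t => good s /\ good t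
  | Scale _ t | Star t => good t
  | Lim u => (forall n, good (u n)) /\
      forall e : R, 0 < e -> exists N, forall m n, (N <= m)%N -> (N <= n)%N ->
        forall r, rnorm (eval r (u m) - eval r (u n)) <= e
  end.

Lemma eval_Lim r (u : nat -> term) : good (Lim u) ->
  eval r (u n) @[n --> \oo] --> eval r (Lim u).
Proof.
move=> [_ uC]; apply: (@rcauchy_cvg _ (rep_alg r) (fun n => eval r (u n))).
by move=> e /uC[N uN]; exists N => m n Nm Nn; exact: uN.
Qed.

Lemma eval_Lim_dist r (u : nat -> term) (e : R) N n : good (Lim u) ->
  (forall m, (N <= m)%N -> rnorm (eval r (u m) - eval r (u n)) <= e) ->
  rnorm (eval r (Lim u) - eval r (u n)) <= e.
Proof.
move=> ug uN; apply/ler_addgt0Pr => d d0.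
have /rcvgP/(_ d d0)[M uM] := @eval_Lim r u ug.
rewrite -(subrKA (eval r (u (maxn N M)))) (le_trans (rnormD _ _))//.
have := uN _ (leq_maxl N M); have := uM _ (leq_maxr N M).
rewrite (rdistC (eval r (Lim u))); lra.
Qed.

Lemma good_bounded t : good t -> exists M : R, forall r, rnorm (eval r t) <= M.
Proof.
elim: t => /= [x _|s IHs t IHt [/IHs[M sM] /IHt[N tN]]|k t IH /IH[M tM]|
    s IHs t IHt [/IHs[M sM] /IHt[N tN]]|t IH /IH[M tM]|u IH ug].
- by exists (8 * rnorm x) => r; exact: rep_bounded.
- by exists (M + N) => r; rewrite (le_trans (rnormD _ _))// lerD.
- exists (normc k * M) => r; rewrite rnormZ ler_wpM2l ?normc_ge0//.
- by exists (M * N) => r; rewrite (le_trans (rnormM _ _))// ler_pM ?rnorm_ge0.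
- by exists M => r; rewrite rnorm_cstar.
(* By uniformity, a single index [N] brings all evaluations of the limit within distance 1 of those
   of [u N]. *)
have [N uN] := ug.2 1 ltr01; have [M uM] := IH N (ug.1 N).
exists (1 + M) => r; rewrite -[X in rnorm X](subrK (eval r (u N))).
rewrite (le_trans (rnormD _ _))// lerD//.
by apply: (@eval_Lim_dist r u 1 N N ug) => m Nm; exact: uN.
Qed.

(** * Good terms modulo equality of all evaluations *)

Definition sim s t := forall r, eval r s = eval r t.

(** For good [t] the class contains [t], so the default [Gen 0] is not taken. Equivalent terms have
    the same class as a set, hence the same chosen element. *)
Definition canon t : term := xget (Gen 0) [set s | good s /\ sim s t].

Lemma canonP t : good t -> good (canon t) /\ sim (canon t) t.
Proof.
move=> gt; rewrite /canon.
by case: xgetP => [s _ //|/(_ t)]; case.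
Qed.

Lemma canon_sim s t : good s -> good t -> sim s t -> canon s = canon t.
Proof.
move=> gs gt st; rewrite /canon; congr (xget _ _).
by apply/seteqP; split=> x [gx h]; split=> // r; rewrite h st.
Qed.

(* The quotient of the good terms by [sim], as canonical representatives. *)
Record envelope := Envelope {
  env_term : term;
  env_good : good env_term;
  env_canon : canon env_term = env_term
}.

Implicit Types x y z : envelope.

HB.instance Definition _ := gen_eqMixin envelope.
HB.instance Definition _ := gen_choiceMixin envelope.

Lemma canon_idem t (h : good t) : canon (canon t) = canon t.
Proof. by apply: canon_sim => //; have [] := canonP h. Qed.

Definition mk t (h : good t) : envelope :=
  Envelope (canonP h).1 (canon_idem h).

Definition ev r x : rep_alg r := eval r (env_term x).

Lemma ev_mk r t (h : good t) : ev r (mk h) = eval r t.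
Proof. exact: (canonP h).2. Qed.

(** Reduces every algebraic identity of the envelope to the same identity in each [rep_alg r]. *)
Lemma env_ext x y : (forall r, ev r x = ev r y) -> x = y.
Proof.
case: x y => [s gs cs] [t gt ct] st.
have e : s = t by rewrite -cs -ct; exact: canon_sim.
by case: _ / e gt ct {st} => gt ct; congr Envelope; exact: Prop_irrelevance.
Qed.

Definition env_add x y : envelope :=
  mk (conj (env_good x) (env_good y) : good (Add _ _)).
Definition env_scale k x : envelope := mk (env_good x : good (Scale k _)).
Definition env_mul x y : envelope :=
  mk (conj (env_good x) (env_good y) : good (Mul _ _)).
Definition env_star x : envelope := mk (env_good x : good (Star _)).
Definition env_gen (a : E) : envelope := mk (I : good (Gen a)).

Lemma ev_add r x y : ev r (env_add x y) = ev r x + ev r y.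
Proof. exact: ev_mk. Qed.
Lemma ev_scale r k x : ev r (env_scale k x) = k *: ev r x.
Proof. exact: ev_mk. Qed.
Lemma ev_mul r x y : ev r (env_mul x y) = cmul (ev r x) (ev r y).
Proof. exact: ev_mk. Qed.
Lemma ev_star r x : ev r (env_star x) = cstar (ev r x).
Proof. exact: ev_mk. Qed.
Lemma ev_gen r a : ev r (env_gen a) = val (rep_map r a).
Proof. exact: ev_mk. Qed.
Lemma ev_gen0 r : ev r (env_gen 0) = 0.
Proof. by rewrite ev_gen raddf0. Qed.

Definition evE := (ev_add, ev_scale, ev_mul, ev_star, ev_gen0, ev_gen).

Fact env_addA : associative env_add.
Proof. by move=> x y z; apply: env_ext => r; rewrite !evE addrA. Qed.
Fact env_addC : commutative env_add.
Proof. by move=> x y; apply: env_ext => r; rewrite !evE addrC. Qed.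
Fact env_add0 : left_id (env_gen 0) env_add.
Proof. by move=> x; apply: env_ext => r; rewrite !evE add0r. Qed.
Fact env_addN : left_inverse (env_gen 0) (env_scale (-1)) env_add.
Proof. by move=> x; apply: env_ext => r; rewrite !evE scaleN1r addNr. Qed.

HB.instance Definition _ :=
  GRing.isZmodule.Build envelope env_addA env_addC env_add0 env_addN.

Fact env_scaleA k l x : env_scale k (env_scale l x) = env_scale (k * l) x.
Proof. by apply: env_ext => r; rewrite !evE scalerA. Qed.
Fact env_scale1 : left_id 1 env_scale.
Proof. by move=> x; apply: env_ext => r; rewrite !evE scale1r. Qed.
Fact env_scaleDr : right_distributive env_scale +%R.
Proof. by move=> k x y; apply: env_ext => r; rewrite !evE scalerDr. Qed.
Fact env_scaleDl x : {morph env_scale^~ x : k l / k + l}.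
Proof. by move=> k l; apply: env_ext => r; rewrite !evE scalerDl. Qed.

HB.instance Definition _ := GRing.Zmodule_isLmodule.Build R[i] envelope
  env_scaleA env_scale1 env_scaleDr env_scaleDl.

Lemma evD r x y : ev r (x + y) = ev r x + ev r y.
Proof. exact: ev_add. Qed.
Lemma evZ r k x : ev r (k *: x) = k *: ev r x.
Proof. exact: ev_scale. Qed.
Lemma evB r x y : ev r (x - y) = ev r x - ev r y.
Proof. by rewrite evD -scaleN1r evZ scaleN1r. Qed.
Lemma ev0 r : ev r 0 = 0.
Proof. exact: ev_gen0. Qed.

(** * The supremum norm over all representations, and completeness *)

Definition env_norm x : R := sup [set s | exists r, s = rnorm (ev r x)].

Lemma env_norm_ub r x : rnorm (ev r x) <= env_norm x.
Proof.
apply: sup_ubound; last by exists r.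
by have [M hM] := good_bounded (env_good x); exists M => _ [r' ->]; exact: hM.
Qed.

Lemma env_norm_le x (M : R) :
  0 <= M -> (forall r, rnorm (ev r x) <= M) -> env_norm x <= M.
Proof.
move=> M0 hM; rewrite /env_norm; set S := (X in sup X).
(* By convention the supremum of the empty set is 0. *)
have [->|/set0P S0] := eqVneq S set0; first by rewrite sup0.
by apply: ge_sup => // _ [r ->].
Qed.

Lemma env_norm_ge0 x : 0 <= env_norm x.
Proof.
have [r _] := triple_embedding E.
exact: le_trans (rnorm_ge0 _) (env_norm_ub r x).
Qed.

Fact env_normD x y :
  (env_norm (x + y))%:C <= (env_norm x)%:C + (env_norm y)%:C.
Proof.
rewrite -rmorphD/= lecR; apply: env_norm_le => [|r].
  by rewrite addr_ge0 ?env_norm_ge0.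
by rewrite evD (le_trans (rnormD _ _))// lerD ?env_norm_ub.
Qed.

Fact env_normZ (k : R[i]) x : (env_norm (k *: x))%:C = `|k| * (env_norm x)%:C.
Proof.
suff -> : env_norm (k *: x) = normc k * env_norm x by rewrite rmorphM.
have le l y : env_norm (l *: y) <= normc l * env_norm y.
  apply: env_norm_le => [|r]; first by rewrite mulr_ge0 ?normc_ge0 ?env_norm_ge0.
  by rewrite evZ rnormZ ler_wpM2l ?normc_ge0 ?env_norm_ub.
apply/le_anti; rewrite le/=.
have [->|k0] := eqVneq k 0; first by rewrite normc0 mul0r env_norm_ge0.
have nk : 0 < normc k.
  by rewrite lt_def normc_ge0 andbT; apply: contraNneq k0 => /eq0_normc ->.
(* The reverse inequality is [le] for the scalar k^-1 and the vector k x. *)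
rewrite -ler_pdivlMl// -normcV -{1}(scalerK k0 x); exact: le.
Qed.

Fact env_norm0 x : (env_norm x)%:C = 0 -> x = 0.
Proof.
move=> /(@complexI R) x0; apply: env_ext => r; rewrite ev0; apply: rnorm0_eq0.
by apply/le_anti; rewrite rnorm_ge0 -x0 env_norm_ub.
Qed.

HB.instance Definition _ :=
  Lmodule_isNormed.Build R[i] envelope env_normD env_normZ env_norm0.

Lemma rnorm_env x : rnorm x = env_norm x.
Proof. by []. Qed.

(** Centres of balls of radius 1/(n+1) belonging to [F] form a Cauchy sequence for the supremum
    norm, that is, uniformly in [r]. Hence [Lim] of their terms is good, and its class is the limit
    of [F]. *)
Fact env_complete (F : set_system envelope) :
  ProperFilter F -> cauchy F -> cvg F.
Proof.
move=> FF /cauchyP Fc.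
have /choice[x xF] n : exists x, F (ball x (n.+1%:R^-1)%:C).
  by apply: Fc; rewrite ltcR.
have small (e : R) : 0 < e -> exists N, forall m n, (N <= m)%N -> (N <= n)%N ->
    rnorm (x m - x n) <= e.
  move=> e0; have [|N hN] := @small_invS R (e / 2); first by lra.
  exists N => m n /hN em /hN en.
  have [y [ym yn]] := filter_ex (filterI (xF m) (xF n)).
  move: ym yn; rewrite -!ball_normE/= !rnormE !ltcR => ym yn.
  rewrite -(subrKA y) (le_trans (rnormD _ _))// (rdistC y).
  by have := le_trans (ltW ym) em; have := le_trans (ltW yn) en; lra.
have xg : good (Lim (env_term \o x)).
  split=> [n|e /small[N hN]]; first exact: env_good.
  exists N => m n Nm Nn r; apply: le_trans (hN m n Nm Nn).
  by have := env_norm_ub r (x m - x n); rewrite evB.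
pose z := mk xg.
apply/cvg_ex; exists z; apply/cvg_ballP => e e0.
have eE : e = (complex.Re e)%:C by rewrite RRe_real// realE ltW.
have e2 : 0 < complex.Re e / 2 by rewrite divr_gt0// -ltcR -eE.
have [N hN] := small _ e2; have [M hM] := small_invS e2.
pose n := maxn N M.
have zx : rnorm (z - x n) <= complex.Re e / 2.
  rewrite rnorm_env; apply: env_norm_le => [|r]; first exact: ltW.
  rewrite evB ev_mk; apply: (@eval_Lim_dist r _ _ N n xg) => m Nm.
  have := hN m n Nm (leq_maxl _ _); apply: le_trans.
  by have := env_norm_ub r (x m - x n); rewrite evB.
apply: filterS (xF n) => y; rewrite -!ball_normE/= eE !rnormE !ltcR => xy.
rewrite -(subrKA (x n)) (le_lt_trans (rnormD _ _))//.
by have := lt_le_trans xy (hM n (leq_maxr _ _)); lra.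
Qed.

HB.instance Definition _ := Uniform_isComplete.Build envelope env_complete.

(** * The C*-algebra structure of the envelope *)

Fact env_mulA : associative env_mul.
Proof. by move=> x y z; apply: env_ext => r; rewrite !evE cmulA. Qed.
Fact env_mulDl : left_distributive env_mul +%R.
Proof. by move=> x y z; apply: env_ext => r; rewrite !(evE, evD) cmulDl. Qed.
Fact env_mulDr : right_distributive env_mul +%R.
Proof. by move=> x y z; apply: env_ext => r; rewrite !(evE, evD) cmulDr. Qed.
Fact env_mulZl (k : R[i]) x y : env_mul (k *: x) y = k *: env_mul x y.
Proof. by apply: env_ext => r; rewrite !(evE, evZ) cmulZl. Qed.
Fact env_mulZr (k : R[i]) x y : env_mul x (k *: y) = k *: env_mul x y.
Proof. by apply: env_ext => r; rewrite !(evE, evZ) cmulZr. Qed.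
Fact env_starD : {morph env_star : x y / x + y}.
Proof. by move=> x y; apply: env_ext => r; rewrite !(evE, evD) cstarD. Qed.
Fact env_starZ (k : R[i]) x : env_star (k *: x) = Num.conj k *: env_star x.
Proof. by apply: env_ext => r; rewrite !(evE, evZ) cstarZ. Qed.
Fact env_starM x y : env_star (env_mul x y) = env_mul (env_star y) (env_star x).
Proof. by apply: env_ext => r; rewrite !evE cstarM. Qed.
Fact env_starK : involutive env_star.
Proof. by move=> x; apply: env_ext => r; rewrite !evE cstarK. Qed.

Lemma env_norm_mul x y : env_norm (env_mul x y) <= env_norm x * env_norm y.
Proof.
apply: env_norm_le => [|r]; first by rewrite mulr_ge0 ?env_norm_ge0.
by rewrite ev_mul (le_trans (rnormM _ _))// ler_pM ?rnorm_ge0 ?env_norm_ub.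
Qed.

Fact env_normM x y : `|env_mul x y| <= `|x| * `|y|.
Proof. by rewrite !rnormE -rmorphM/= lecR env_norm_mul. Qed.

Fact env_norm_star x : `|env_mul (env_star x) x| = `|x| ^+ 2.
Proof.
rewrite !rnormE -rmorphXn/= !rnorm_env; congr (_%:C); apply/le_anti/andP; split.
  apply: env_norm_le => [|r]; first exact: sqr_ge0.
  rewrite ev_mul ev_star rnorm_cstarM ler_pXn2r ?nnegrE ?rnorm_ge0 ?env_norm_ge0//.
  exact: env_norm_ub.
(* In the form |x| <= sqrt |x* x|, the bound can be checked in each representation by its
   C*-identity. *)
rewrite -[leRHS]sqr_sqrtr ?env_norm_ge0//.
rewrite ler_pXn2r ?nnegrE ?sqrtr_ge0 ?env_norm_ge0//.
apply: env_norm_le => [|r]; first exact: sqrtr_ge0.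
rewrite -(@ler_pXn2r _ 2) ?nnegrE ?rnorm_ge0 ?sqrtr_ge0// sqr_sqrtr.
  by rewrite -rnorm_cstarM -ev_star -ev_mul env_norm_ub.
exact: env_norm_ge0.
Qed.

HB.instance Definition _ := isCStarAlgebra.Build R envelope
  env_mulA env_mulDl env_mulDr env_mulZl env_mulZr env_starD env_starZ
  env_starM env_starK env_normM env_norm_star.

End Terms.

(** * The universal TRO *)

Section Universal.
Context {R : realType}.

(** The intersection of all sub-TROs of [A] that contain [G]. *)
Lemma generated_tro (A : cstarAlgType R) (G : set A) :
  exists S : submodClosed A, [/\ is_tro S, (forall x, G x -> x \in S) &
    forall S' : submodClosed A, is_tro S' -> (forall x, G x -> x \in S') ->
      {subset S <= S'}].
Proof.
pose P (x : A) := forall S : submodClosed A, is_tro S ->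
  (forall y, G y -> y \in S) -> x \in S.
have [S SP] : exists S : submodClosed A, forall x, x \in S <-> P x.
  apply: submodClosed_of => [S _ _|x y Px Py S tS GS|k x Px S tS GS].
  - exact: rpred0.
  - by apply: rpredD; [exact: Px|exact: Py].
  - by apply: rpredZ; exact: Px.
exists S; split=> [|x Gx|S' tS' GS' x /SP]; last 2 first.
- by apply/SP => S' _; exact.
- exact.
split=> [|a b c /SP Pa /SP Pb /SP Pc].
  apply: closed_seqP => u x uS ux; apply/SP => S' tS' GS'.
  by apply: (closed_rcvg tS'.1 _ ux) => n /=; move/SP: (uS n); exact.
by apply/SP => S' tS' GS'; apply: tS'.2; [exact: Pa|exact: Pb|exact: Pc].
Qed.

Lemma tro_hom_eq (S T : tro R) (X : set S) (f g : {linear S -> T}) :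
  tro_hom f -> tro_hom g -> tro_generates X -> (forall x, X x -> f x = g x) ->
  f =1 g.
Proof.
move=> fh gh Xgen fg.
(* The equalizer, viewed in the ambient algebra, where [tro_generates] takes its subspaces. *)
pose P (y : tro_ambient S) := exists x : S, val x = y /\ f x = g x.
have [S' SP] : exists S' : submodClosed (tro_ambient S),
    forall x, x \in S' <-> P x.
  apply: submodClosed_of.
  - by exists 0; rewrite !raddf0.
  - move=> _ _ [x [<- xE]] [y [<- yE]]; exists (x + y).
    by rewrite !raddfD/= xE yE.
  - by move=> k _ [x [<- xE]]; exists (k *: x); rewrite !linearZ/= xE.
have S'tro : is_tro S'.
  split=> [|_ _ _ /SP[a [<- aE]] /SP[b [<- bE]] /SP[c [<- cE]]]; last first.
    by apply/SP; exists (tro_prod a b c); rewrite fh gh aE bE cE.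
  apply: closed_seqP => u y uS uy; apply/SP.
  have /choice[x xP] n : P (u n) by apply/SP; exact: uS.
  have yS : y \in tro_space S.
    apply: (closed_rcvg (tro_axiom S).1 _ uy) => n /=.
    by rewrite -(xP n).1; exact: submod_valP.
  pose z : S := Submod yS; exists z; split=> //.
  apply/eqP; rewrite -subr_eq0; apply/eqP/val_inj/rnorm0_eq0/eqP.
  rewrite eq_le rnorm_ge0 andbT; apply/ler_addgt0Pr => e e0; rewrite add0r.
  (* [f] and [g] agree at [x N], and each has bound 8, so |f z - g z| <= 2 * 8 * (e / 16). *)
  have e16 : 0 < e / 16 by rewrite divr_gt0.
  have [N /(_ _ (leqnn N)) uN] := (rcvgP _ _).1 uy _ e16.
  have -> : val (f z - g z) = val (f (z - x N)) - val (g (z - x N)).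
    rewrite -[RHS]raddfB (linearB f) (linearB g) (xP N).2; congr val.
    by rewrite opprB addrA subrK.
  rewrite (le_trans (rnormB _ _))//.
  have := tro_hom_bounded fh (z - x N); have := tro_hom_bounded gh (z - x N).
  have -> : rnorm (val (z - x N)) = rnorm (u N - y).
    by rewrite raddfB/= (xP N).1 rdistC.
  lra.
move=> x; have : val x \in S'.
  apply: Xgen => // [y /SP[z [<- _]]|y Xy]; first exact: submod_valP.
  by apply/SP; exists y; split=> //; exact: fg.
by move=> /SP[y [yx]]; rewrite (val_inj yx).
Qed.

Lemma ev_ternary (E : jcstarTripleType R) (r : triple_rep E)
    (x y z : @envelope R E) :
  ev r (ternary x y z) = ternary (ev r x) (ev r y) (ev r z).
Proof.
by rewrite /ternary -[RHS]/(cmul (cmul _ _) _) -ev_star -!ev_mul.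
Qed.

(** The preimage of the target under [ev r], which is contractive for the supremum norm. Minimality
    of the generated TRO will place that TRO inside this preimage. *)
Lemma ev_tro (E : jcstarTripleType R) (r : triple_rep E) :
  exists S : submodClosed (@envelope R E), is_tro S /\
    forall x, x \in S <-> ev r x \in tro_space (rep_tro r).
Proof.
have [S SP] : exists S : submodClosed (@envelope R E),
    forall x, x \in S <-> ev r x \in tro_space (rep_tro r).
  apply: (@submodClosed_of _ (@envelope R E)).
  - by rewrite ev0; exact: rpred0.
  - by move=> x y xS yS; rewrite evD; exact: rpredD.
  - by move=> k x xS; rewrite evZ; exact: rpredZ.
exists S; split=> //; split=> [|a b c /SP aS /SP bS /SP cS].
  apply: closed_seqP => u x uS ux; apply/SP.
  apply: (@closed_rcvg _ _ _ (fun n => ev r (u n)) _ (tro_axiom (rep_tro r)).1).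
    by move=> n; apply/SP; exact: uS.
  apply/rcvgP => e /((rcvgP _ _).1 ux)[N uN]; exists N => n /uN.
  by apply: le_trans; rewrite -evB; exact: env_norm_ub.
by apply/SP; rewrite ev_ternary; exact: (tro_axiom (rep_tro r)).2.
Qed.

Lemma tro_hom_comp (S T U : tro R) (f : {linear S -> T}) (g : {linear T -> U}) :
  tro_hom f -> tro_hom g -> tro_hom (g \o f).
Proof. by move=> fh gh a b c; rewrite /= fh gh. Qed.

Lemma universal_tro_exists (E : jcstarTripleType R) :
  exists (T : tro R) (alpha : {linear E -> T}), universal_tro alpha.
Proof.
have [S [Stro GS Smin]] := generated_tro (range (@env_gen R E)).
have genS a : env_gen a \in S by apply: GS; exists a.
pose T := Tro Stro.
have [alpha alphaE] : exists alpha : {linear E -> T},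
    alpha =1 fun a => Submod (genS a).
  apply: (@linear_of _ E T) => k x y; apply: val_inj => /=.
  (* [env_gen] is linear because every [rep_map r] is; the triple product is treated likewise
     below. *)
  apply: env_ext => r; rewrite evD evZ !ev_gen.
  by rewrite linearP.
have alpha_val a : val (alpha a) = env_gen a by rewrite alphaE.
have alpha_hom : triple_hom alpha.
  move=> a b c; apply: val_inj; rewrite val_tro_triple !alpha_val.
  apply: env_ext => r; rewrite evZ evD !ev_ternary !ev_gen rep_hom.
  by rewrite val_tro_triple.
have alpha_gen : tro_generates (range alpha).
  move=> S' tS' _ aS' x; apply: (Smin S' tS'); last exact: submod_valP.
  by move=> _ [a _ <-]; rewrite -alpha_val; apply: aS'; exists a.
exists T, alpha; split=> // [a b ab|U pi pih].
  have [r rI] := triple_embedding E; apply/rI/val_inj.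
  by rewrite -!ev_gen -!alpha_val ab.
(* [pi] is itself one of the representations, so evaluation along it restricts to the required
   extension. *)
pose r := TripleRep pih.
have [S' [tS' SP]] := ev_tro r.
have evT (x : T) : ev r (val x) \in tro_space U.
  apply/SP; apply: (Smin S' tS'); last exact: submod_valP.
  by move=> _ [a _ <-]; apply/SP; rewrite ev_gen; exact: submod_valP.
have [pi' piE] : exists pi' : {linear T -> U}, pi' =1 fun x => Submod (evT x).
  apply: (@linear_of _ T U) => k x y; apply: val_inj => /=.
  by rewrite evD evZ.
have pi'_val x : val (pi' x) = ev r (val x) by rewrite piE.
have pi'_hom : tro_hom pi'.
  move=> a b c; apply: val_inj; rewrite [LHS]pi'_val !val_tro_prod !pi'_val.
  exact: (ev_ternary r).
have pi'_ext : pi' \o alpha =1 pi.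
  by move=> a; apply: val_inj; rewrite /= pi'_val alpha_val ev_gen.
exists pi'; split=> // rho rhoh rhoE; apply: (tro_hom_eq rhoh pi'_hom alpha_gen).
by move=> _ [a _ <-]; rewrite -[LHS]/((rho \o alpha) a) rhoE -pi'_ext.
Qed.

(** Both [g \o f] and the identity are TRO homomorphisms, and they agree on the generating set
    [range alpha]. *)
Lemma universal_tro_retract (E : jcstarTripleType R) (S T : tro R)
    (alpha : {linear E -> S}) (f : {linear S -> T}) (g : {linear T -> S}) :
  universal_tro alpha -> tro_hom f -> tro_hom g ->
  g \o (f \o alpha) =1 alpha -> cancel f g.
Proof.
move=> [_ _ gen _] fh gh gfa.
have idh : tro_hom (idfun : {linear S -> S}) by [].
apply: (tro_hom_eq (tro_hom_comp fh gh) idh gen) => _ [a _ <-].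
exact: gfa.
Qed.

End Universal.

Theorem corollary3p2 (R : realType) (E : jcstarTripleType R) :
  exists (T : tro R) (alpha : {linear E -> T}),
    universal_tro alpha /\
    (forall (S : tro R) (beta : {linear E -> S}), universal_tro beta ->
       exists theta : {linear T -> S}, tro_iso theta /\ theta \o alpha =1 beta).
Proof.
have [T [alpha alphaU]] := universal_tro_exists E.
exists T, alpha; split=> // S beta betaU.
have [alpha_hom _ _ /(_ S beta)] := alphaU.
have [beta_hom _ _ /(_ T alpha)] := betaU.
move=> /(_ alpha_hom)[g [gh gE _]] /(_ beta_hom)[f [fh fE _]].
(* The extension [f] of [beta] and the extension [g] of [alpha] are mutually inverse. *)
exists f; split=> //; split=> //; exists g.
  apply: (universal_tro_retract alphaU) => // a.
  by rewrite /= [f _]fE -[LHS]/((g \o beta) a) gE.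
apply: (universal_tro_retract betaU) => // a.
by rewrite /= [g _]gE -[LHS]/((f \o alpha) a) fE.
Qed.
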